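(* Let $\Gamma$ be a $\mathbb{Z}$-periodic graph with a one-element fundamental cell, with weight $w:\mathbb{Z}\to[0,\infty)$ and constant potential $Q\in\mathbb{R}$, let $(\mathcal{H}_\Gamma f)(n)=\sum_{k\in\mathbb{Z}}w(k)f(n+k)+Qf(n)$ on $\ell^2(\mathbb{Z})$, and let $T=[\mathcal{H}_\Gamma,\mathbf{1}]=\mathcal{H}_\Gamma\mathbf{1}-\mathbf{1}\mathcal{H}_\Gamma$, where $\mathbf{1}$ is the operator of multiplication by the indicator function of $\{n\in\mathbb{Z}:n\ge 0\}$. (a) Under the standing assumptions $w\ge 0$, $w\in\ell^1(\mathbb{Z})$ and $w(-k)=w(k)$, the operator $T$ is compact, i.e. $\mathcal{H}_\Gamma$ is essentially local. (b) If moreover $w(k)$ decreases with $|k|$ (for $k\neq 0$), or $w$ is ''sup-summable'' in the sense that $\sum_{k\ge 1}\sup_{n\ge k}w(n)<\infty$, then $T$ is a Hilbert–Schmidt operator. (c) If the extra assumption of (b) is dropped, $T$ is no longer necessarily Hilbert–Schmidt: there exists such a graph $\Gamma$ satisfying the standing assumptions for which $T$ is not Hilbert–Schmidt.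
   Context: A $\mathbb{Z}$-periodic graph with one-element fundamental cell is given by vertex set $\mathbb{Z}$, a weight $w:\mathbb{Z}\to[0,\infty)$ with $w(0)=0$, $w(-k)=w(k)$, $\sum_k w(k)<\infty$, where $n$ and $n+k$ are joined by an edge of weight $w(k)$ whenever $w(k)>0$, such that the resulting graph is connected, together with a constant potential $Q\in\mathbb{R}$. A bounded operator $\mathcal{H}$ on $\ell^2(\mathbb{Z})$ is called essentially local if the commutator $[\mathcal{H},\mathbf{1}]$ with the half-line cutoff is compact. *)

(* Defs.v *)
From HB Require Import structures.
From mathcomp Require Import all_boot all_order all_algebra finmap complex.
From mathcomp Require Import all_classical all_reals.
From mathcomp Require Import ereal topology normedtype sequences esum.
From mathcomp Require summability.
From mathcomp Require Import ring.

Set Implicit Arguments.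
Unset Strict Implicit.
Unset Printing Implicit Defensive.

Import Order.TTheory GRing.Theory Num.Theory numFieldNormedType.Exports.
Local Open Scope classical_set_scope.
Local Open Scope ring_scope.
Local Open Scope complex_scope.

Notation normc := ComplexField.Normc.normc.

Section square_summable.
Context {R : realType}.
Implicit Types (f g : int -> R[i]^o) (J : {fset int}) (M : R).

Lemma esum_le_fset (I : choiceType) (a : I -> R) M :
  (forall J : {fset I}, \sum_(i <- J) a i <= M) <->
  (\esum_(i in [set: I]) (a i)%:E <= M%:E)%E.
Proof.
split=> [aM|aM J].
  apply: ge_ereal_sup => _ [A [finA _] <-].
  by rewrite fsbig_finite//= sumEFin lee_fin; exact: aM.
rewrite -lee_fin -sumEFin; apply: le_trans aM.
apply: esum_ge; exists [set` J]; first by split => //; exact: finite_fset.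
by rewrite fsbig_finite//= set_fsetK.
Qed.

Lemma normc_ge0 (x : R[i]) : 0 <= normc x.
Proof. by case: x => a b; exact: sqrtr_ge0. Qed.

Lemma normcE (x : R[i]) : `|x| = (normc x)%:C.
Proof. by []. Qed.

Lemma normc_triangle (x y : R[i]) : normc (x + y) <= normc x + normc y.
Proof. exact: le_normcD. Qed.

Definition sqnorm f : \bar R :=
  (\esum_(n in [set: int]) (normc (f n) ^+ 2)%:E)%E.

Definition square_summable : {pred int -> R[i]^o} :=
  fun f => `[< (sqnorm f < +oo)%E >].

Definition l2norm f : R := Num.sqrt (fine (sqnorm f)).

(* [f] is square-summable of norm at most [M], without extended reals. *)
Definition l2bound f M :=
  0 <= M /\ forall J, \sum_(n <- J) normc (f n) ^+ 2 <= M ^+ 2.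

Lemma l2norm_ge0 f : 0 <= l2norm f. Proof. exact: sqrtr_ge0. Qed.

Lemma sqnorm_ge0 f : (0 <= sqnorm f)%E.
Proof. by apply: esum_ge0 => n _; rewrite lee_fin exprn_ge0// normc_ge0. Qed.

Lemma square_summableE f : f \in square_summable ->
  sqnorm f = (l2norm f ^+ 2)%:E.
Proof.
move=> /asboolP foo; have f0 := sqnorm_ge0 f.
by rewrite sqr_sqrtr ?fine_ge0// fineK// ge0_fin_numE.
Qed.

Lemma l2bound_norm f : f \in square_summable -> l2bound f (l2norm f).
Proof.
move=> fP; split; first exact: l2norm_ge0.
by apply/esum_le_fset; rewrite -square_summableE.
Qed.

Lemma l2boundP f M : l2bound f M -> f \in square_summable /\ l2norm f <= M.
Proof.
move=> [M0 /esum_le_fset fM].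
have fP : f \in square_summable.
  by apply/asboolP; apply: le_lt_trans fM _; rewrite ltry.
split=> //; rewrite -(@ler_pXn2r _ 2) ?nnegrE ?l2norm_ge0//.
by rewrite -lee_fin -square_summableE.
Qed.

Lemma l2bound_eval f M n : l2bound f M -> normc (f n) <= M.
Proof.
move=> [M0 /(_ [fset n]%fset)]; rewrite big_seq_fset1.
by rewrite ler_pXn2r// nnegrE normc_ge0.
Qed.

Lemma l2boundD f g M N : 0 < M -> 0 < N -> l2bound f M -> l2bound g N ->
  l2bound (f + g) (M + N).
Proof.
move=> M0 N0 [_ fM] [_ gN]; split; first by rewrite addr_ge0// ltW.
move=> J; pose t := N / M.
have t0 : 0 < t by rewrite divr_gt0.
apply: (@le_trans _ _ (\sum_(n <- J) ((1 + t) * normc (f n) ^+ 2 +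
    (1 + t^-1) * normc (g n) ^+ 2))).
  apply: ler_sum => n _.
  apply: (@le_trans _ _ ((normc (f n) + normc (g n)) ^+ 2)).
    by rewrite ler_pXn2r ?nnegrE ?addr_ge0 ?normc_ge0 ?normc_triangle.
  rewrite -subr_ge0; set a := normc (f n); set b := normc (g n).
  have -> : (1 + t) * a ^+ 2 + (1 + t^-1) * b ^+ 2 - (a + b) ^+ 2 =
    t^-1 * (t * a - b) ^+ 2 by field; rewrite gt_eqF.
  by rewrite mulr_ge0 ?sqr_ge0// invr_ge0 ltW.
rewrite big_split/= -!mulr_sumr.
apply: (@le_trans _ _ ((1 + t) * M ^+ 2 + (1 + t^-1) * N ^+ 2)).
  by rewrite lerD// ler_wpM2l// addr_ge0 ?invr_ge0 ?ltW.
have -> : (1 + t) * M ^+ 2 + (1 + t^-1) * N ^+ 2 = (M + N) ^+ 2.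
  by rewrite /t; field; rewrite !gt_eqF.
by [].
Qed.

Lemma l2bound_le f M N : M <= N -> l2bound f M -> l2bound f N.
Proof.
move=> MN [M0 fM]; split; first exact: le_trans MN.
by move=> J; rewrite (le_trans (fM J))// ler_pXn2r// nnegrE (le_trans M0).
Qed.

Lemma l2boundZ c f M : l2bound f M -> l2bound (c *: f) (normc c * M).
Proof.
move=> [M0 fM]; split; first by rewrite mulr_ge0// normc_ge0.
move=> J; rewrite exprMn.
under eq_bigr do rewrite ComplexField.Normc.normcM exprMn.
by rewrite -mulr_sumr ler_wpM2l// sqr_ge0.
Qed.

Lemma l2bound0 : l2bound 0 0.
Proof.
split=> // J; rewrite big1 ?expr0n// => n _.
by rewrite [normc _]ComplexField.Normc.normc0 expr0n.
Qed.

Lemma l2bound_normP f M : (forall e, 0 < e -> l2bound f (M + e)) ->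
  f \in square_summable /\ l2norm f <= M.
Proof.
move=> fM; split; first by have [] := l2boundP (fM 1 ltr01).
by apply/ler_addgt0Pr => e e0; have [] := l2boundP (fM e e0).
Qed.

Lemma l2normD f g : f \in square_summable -> g \in square_summable ->
  f + g \in square_summable /\ l2norm (f + g) <= l2norm f + l2norm g.
Proof.
move=> /l2bound_norm fP /l2bound_norm gP.
apply: l2bound_normP => e e0.
have -> : l2norm f + l2norm g + e = (l2norm f + e / 2) + (l2norm g + e / 2).
  by field.
apply: l2boundD; rewrite ?ltr_wpDl ?divr_gt0 ?l2norm_ge0//.
  by apply: l2bound_le fP; rewrite lerDl divr_ge0// ltW.
by apply: l2bound_le gP; rewrite lerDl divr_ge0// ltW.
Qed.

Lemma l2normZ_le c f : f \in square_summable ->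
  c *: f \in square_summable /\ l2norm (c *: f) <= normc c * l2norm f.
Proof. by move=> fP; exact/l2boundP/l2boundZ/l2bound_norm. Qed.

Lemma l2normZ c f : f \in square_summable ->
  l2norm (c *: f) = normc c * l2norm f.
Proof.
move=> fP; have [cfP cf_le] := l2normZ_le c fP.
apply/eqP; rewrite eq_le cf_le/=.
have [->|c0] := eqVneq c 0.
  by rewrite [normc _]ComplexField.Normc.normc0 mul0r l2norm_ge0.
have nc0 : 0 < normc c.
  rewrite lt_neqAle normc_ge0 andbT eq_sym.
  by apply: contra c0 => /eqP /ComplexField.Normc.eq0_normc ->.
have [_] := l2normZ_le c^-1 cfP.
by rewrite scalerA mulVf// scale1r ComplexField.Normc.normcV ler_pdivlMl.
Qed.

Lemma square_summable_submod_closed : submod_closed square_summable.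
Proof.
split; first by have [] := l2boundP l2bound0.
move=> c f g fP gP; have [cfP _] := l2normZ_le c fP.
by have [] := l2normD cfP gP.
Qed.

HB.instance Definition _ := GRing.isSubmodClosed.Build R[i] (int -> R[i]^o)
  square_summable square_summable_submod_closed.

End square_summable.

(* Complex-valued; below it is made a normed module over [R[i]], whose norm
   takes values in [R[i]]. *)
Record l2 (R : realType) := L2 {
  l2_fun :> int -> R[i]^o ;
  l2P : l2_fun \in square_summable }.

Section l2_normed.
Context {R : realType}.

HB.instance Definition _ := [isSub for @l2_fun R].
HB.instance Definition _ := [Choice of l2 R by <:].
HB.instance Definition _ := [SubChoice_isSubLmodule of l2 R by <:].

Definition l2_norm (f : l2 R) : R[i] := (l2norm f)%:C.

Lemma l2_normD (f g : l2 R) : l2_norm (f + g) <= l2_norm f + l2_norm g.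
Proof.
rewrite /l2_norm -rmorphD/= lecR.
by have [] := l2normD (l2P f) (l2P g).
Qed.

Lemma l2_normZ (c : R[i]) (f : l2 R) : l2_norm (c *: f) = `|c| * l2_norm f.
Proof. by rewrite /l2_norm normcE -rmorphM/= -(l2normZ c (l2P f)). Qed.

Lemma l2_norm_eq0 (f : l2 R) : l2_norm f = 0 -> f = 0.
Proof.
move=> /complexI f0; apply/val_inj/funext => n.
apply: ComplexField.Normc.eq0_normc; apply/eqP; rewrite eq_le normc_ge0 andbT.
by rewrite -f0; exact/l2bound_eval/l2bound_norm/l2P.
Qed.

HB.instance Definition _ :=
  Lmodule_isNormed.Build R[i] (l2 R) l2_normD l2_normZ l2_norm_eq0.

End l2_normed.


#[global] Existing Instance summability.totally_filter.

Section absolutely_summable.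
Context {R : realType} {I : choiceType}.
Import summability.
Implicit Types (J : {fset I}).

Lemma partial_sumE (V : zmodType) (x : I -> V) J :
  partial_sum x J = \sum_(i <- J) x i.
Proof. by rewrite /partial_sum [RHS]big_seq_fsetE. Qed.

Lemma nneg_cvg_sum (a : I -> R) (M : R) : (forall i, 0 <= a i) ->
    (forall J, \sum_(i <- J) a i <= M) ->
  exists s : R, partial_sum a J @[J --> totally] --> s.
Proof.
move=> a0 aM; pose E := range (partial_sum a).
have supE : has_sup E.
  split; first by exists (partial_sum a fset0), fset0.
  by exists M => _ [J _ <-]; rewrite partial_sumE.
exists (sup E); apply/cvgrPdist_lt => e e0.
have [_ [J _ <-] eJ] := sup_adherent e0 supE.
exists J => // K /= JK.
have le_sup : partial_sum a K <= sup E by apply: (sup_upper_bound supE); exists K.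
rewrite ger0_norm ?subr_ge0// ltrBlDr addrC -ltrBlDr; apply: lt_le_trans eJ _.
rewrite !partial_sumE [leRHS](big_fsetID _ [in J])/=.
have -> : [fset x in K | x \in J]%fset = J.
  apply/fsetP => i; rewrite !inE; case: (boolP (i \in J)) => [iJ|_]; rewrite ?andbF// andbT; exact: (fsubsetP JK).
by rewrite lerDl sumr_ge0.
Qed.

Lemma abs_cvg_sum (a : I -> R) (M : R) :
    (forall J, \sum_(i <- J) `|a i| <= M) ->
  exists s : R, partial_sum a J @[J --> totally] --> s.
Proof.
move=> aM.
have [s1 Hs1] : exists s : R, partial_sum (fun i => a i + `|a i|) J @[J --> totally] --> s.
  apply: (@nneg_cvg_sum _ (M + M)) => [i|J].
    by rewrite -lerBlDr sub0r lerNl -normrN ler_norm.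
  rewrite (le_trans _ (lerD (aM J) (aM J)))// -big_split/= ler_sum// => i _.
  by rewrite lerD2r ler_norm.
have [s2 Hs2] := @nneg_cvg_sum (fun i => `|a i|) M (fun=> normr_ge0 _) aM.
exists (s1 - s2).
have -> : partial_sum a = partial_sum (fun i => a i + `|a i|) -
                          partial_sum (fun i => `|a i|).
  apply/funext => J; rewrite -[RHS]/(partial_sum _ J - partial_sum _ J).
  rewrite !partial_sumE -sumrB.
  by apply: eq_bigr => i _; rewrite addrK.
exact: cvgB Hs1 Hs2.
Qed.

Lemma cvg_complexP (F : set_system {fset I}) {FF : Filter F}
    (x : {fset I} -> R[i]^o) (l : R[i]^o) :
  x J @[J --> F] --> l <-> normc (l - x J) @[J --> F] --> (0 : R).
Proof.
split=> [/cvgrPdist_lt xl|xl].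
  apply/cvgrPdist_lt => e e0.
  have e0' : 0 < e%:C by rewrite ltcR.
  apply: filterS (xl _ e0') => J xJ.
  by rewrite sub0r normrN ger0_norm ?normc_ge0// -ltcR.
apply/cvgrPdist_lt => e e0; have /cvgrPdist_lt := xl => /(_ (complex.Re e)).
have eE : e = (complex.Re e)%:C by rewrite RRe_real// gtr0_real.
have e0' : 0 < complex.Re e by rewrite -ltcR -eE.
move=> /(_ e0'); apply: filterS => J.
by rewrite sub0r normrN ger0_norm ?normc_ge0// -ltcR -eE; exact.
Qed.

Lemma normc_le_ReIm (x : R[i]) :
  normc x <= `|complex.Re x| + `|complex.Im x|.
Proof.
case: x => a b /=; rewrite -(@ler_pXn2r _ 2) ?nnegrE ?sqrtr_ge0 ?addr_ge0//.
rewrite sqr_sqrtr ?addr_ge0 ?sqr_ge0// sqrrD !real_normK ?num_real//.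
by rewrite -addrA lerD2l lerDr mulrn_wge0// mulr_ge0.
Qed.

Lemma ReIm_le_normc (x : R[i]) :
  `|complex.Re x| <= normc x /\ `|complex.Im x| <= normc x.
Proof.
by case: x => a b /=; split; rewrite -sqrtr_sqr ler_wsqrtr// (lerDl,lerDr) sqr_ge0.
Qed.

Lemma normc_cvg_sum (x : I -> R[i]^o) (M : R) :
    (forall J, \sum_(i <- J) normc (x i) <= M) ->
  partial_sum x J @[J --> totally] --> summability.sum x.
Proof.
move=> xM.
have [|s1 Hs1] := @abs_cvg_sum (fun i => complex.Re (x i)) M.
  by move=> J; apply: le_trans (xM J); apply: ler_sum => i _; case: (ReIm_le_normc (x i)).
have [|s2 Hs2] := @abs_cvg_sum (fun i => complex.Im (x i)) M.
  by move=> J; apply: le_trans (xM J); apply: ler_sum => i _; case: (ReIm_le_normc (x i)).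
suff xs : partial_sum x J @[J --> totally] --> (s1 +i* s2 : R[i]^o).
  by rewrite /summability.sum (cvg_lim _ xs)//; exact: norm_hausdorff.
apply/cvg_complexP.
have Hs : `|s1 - partial_sum (fun i => complex.Re (x i)) J| +
          `|s2 - partial_sum (fun i => complex.Im (x i)) J|
          @[J --> totally] --> (0 : R).
  rewrite -[0]addr0; apply: cvgD.
    by rewrite -[0](@normr0 _ R) -(subrr s1); apply: cvg_norm; apply: cvgB => //; exact: cvg_cst.
  by rewrite -[0](@normr0 _ R) -(subrr s2); apply: cvg_norm; apply: cvgB => //; exact: cvg_cst.
apply: squeeze_cvgr (cvg_cst 0) Hs; near=> J.
rewrite normc_ge0/= (le_trans (normc_le_ReIm _))//.
have -> : partial_sum x J = partial_sum (fun i => complex.Re (x i)) J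
       +i* partial_sum (fun i => complex.Im (x i)) J :> R[i].
  rewrite !partial_sumE; elim: (enum_fset J) => [|i r IH]; first by rewrite !big_nil.
  by rewrite !big_cons IH; case: (x i).
by [].
Unshelve. all: by end_near. Qed.

End absolutely_summable.

Section convolution.
Context {R : realType}.
Import summability.
Implicit Types (f g : int -> R[i]^o) (J : {fset int}).
Variables (w : int -> R) (W : R).
Hypotheses (w_ge0 : forall k, 0 <= w k)
  (w_le : forall J, \sum_(k <- J) w k <= W).

(* [summability.sum] is the limit along the net of finite partial sums; by
   [convolution_cvg] below it converges on square-summable [f]. *)
Definition convolution f : int -> R[i]^o :=
  fun n => summability.sum (fun k => (w k)%:C * f (n + k) : R[i]^o).

Let term f (n k : int) : R[i]^o := (w k)%:C * f (n + k).

Lemma normc_real (x : R) : 0 <= x -> normc x%:C = x.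
Proof. by move=> x0; rewrite /= expr0n/= addr0 sqrtr_sqr ger0_norm. Qed.

Lemma normc_convolution_term f M n : l2bound f M ->
  forall J, \sum_(k <- J) normc (term f n k) <= W * M.
Proof.
move=> fM J; apply: (@le_trans _ _ ((\sum_(k <- J) w k) * M)).
  rewrite mulr_suml ler_sum// => k _.
  by rewrite ComplexField.Normc.normcM normc_real// ler_wpM2l// l2bound_eval.
by rewrite ler_wpM2r//; case: fM.
Qed.

Lemma convolution_cvg f n : f \in square_summable ->
  partial_sum (term f n) J @[J --> totally] --> convolution f n.
Proof.
by move=> /l2bound_norm fM; exact: normc_cvg_sum (normc_convolution_term n fM).
Qed.

Lemma l2bound_shift f k M : l2bound f M -> l2bound (fun n => f (n + k)) M.
Proof.
move=> [M0 /esum_le_fset fM]; split=> //; apply/esum_le_fset.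
rewrite (reindex_esum setT setT (fun n : int => n + k)) in fM => //.
split => //; first by move=> x y _ _ /addIr.
by move=> m _; exists (m - k) => //; rewrite subrK.
Qed.

Lemma l2bound_add f g M N : l2bound f M -> l2bound g N -> l2bound (f + g) (M + N).
Proof.
move=> /l2boundP[fP fM] /l2boundP[gP gN]; have [fgP fg_le] := l2normD fP gP.
by apply: l2bound_le (l2bound_norm fgP); rewrite (le_trans fg_le)// lerD.
Qed.

Lemma l2bound_partial f M J : l2bound f M ->
  l2bound (fun n => partial_sum (term f n) J) (W * M).
Proof.
move=> fM; apply: (@l2bound_le _ _ ((\sum_(k <- J) w k) * M)).
  by rewrite ler_wpM2r//; case: fM.
under eq_fun do rewrite partial_sumE.
elim: (enum_fset J) => [|k s IH].
  under eq_fun do rewrite big_nil.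
  by rewrite big_nil mul0r; exact: l2bound0.
under eq_fun do rewrite big_cons.
rewrite big_cons mulrDl; apply: l2bound_add IH.
have := l2boundZ (w k)%:C (l2bound_shift k fM).
by rewrite normc_real.
Qed.

Lemma normc_dist (x y : R[i]) : `|normc x - normc y| <= normc (x - y).
Proof.
have le_dist (u v : R[i]) : normc u - normc v <= normc (u - v).
  by rewrite lerBlDr; have := normc_triangle (u - v) v; rewrite subrK.
have normcB (u v : R[i]) : normc (u - v) = normc (v - u).
  by rewrite -opprB [LHS](@normcN R).
by rewrite ler_norml le_dist andbT lerNl opprB normcB le_dist.
Qed.

Lemma l2bound_convolution f M : l2bound f M -> l2bound (convolution f) (W * M).
Proof.
move=> fM; have [fP _] := l2boundP fM.
have [WM0 _] := l2bound_partial fset0 fM.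
split=> // J.
have normc_cvg n : normc (partial_sum (term f n) K) @[K --> totally] -->
    normc (convolution f n).
  have /cvg_complexP cn := @convolution_cvg f n fP.
  apply/cvgrPdist_lt => e e0.
  have /cvgrPdist_lt /(_ e e0) := cn; apply: filterS => K.
  rewrite sub0r normrN [X in X < _ -> _]ger0_norm ?normc_ge0//.
  exact/le_lt_trans/normc_dist.
have sum_cvg : \sum_(n <- J) normc (partial_sum (term f n) K) ^+ 2
    @[K --> totally] --> \sum_(n <- J) normc (convolution f n) ^+ 2.
  elim: (enum_fset J) => [|n s IH].
    by rewrite big_nil; under eq_fun do rewrite big_nil; exact: cvg_cst.
  rewrite big_cons; under eq_fun do rewrite big_cons.
  by apply: cvgD IH; rewrite expr2; under eq_fun do rewrite expr2; exact: cvgM.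
rewrite -(cvg_lim _ sum_cvg)//; apply: limr_le; first by apply/cvg_ex; eexists; exact: sum_cvg.
by near=> K; case: (l2bound_partial K fM).
Unshelve. all: by end_near. Qed.

Lemma convolution_linear (c : R[i]) f g :
  f \in square_summable -> g \in square_summable ->
  convolution (c *: f + g) = c *: convolution f + convolution g.
Proof.
move=> fP gP; apply/funext => n.
have cfP : c *: f + g \in square_summable.
  by have [_] := @square_summable_submod_closed R; apply.
have := cvgD (cvgZr (k := c) (@convolution_cvg _ n fP)) (@convolution_cvg _ n gP).
move=> H; apply: (cvg_unique (@norm_hausdorff _ _) (@convolution_cvg _ n cfP)).
have -> : partial_sum (term (c *: f + g) n) =
    fun J => c *: partial_sum (term f n) J + partial_sum (term g n) J.
  apply/funext => J; rewrite !partial_sumE scaler_sumr -big_split/=.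
  apply: eq_bigr => k _; rewrite /term -[(c *: f + g) _]/(c * f (n + k) + g (n + k)).
  by rewrite -[_ *: _]/(c * _) mulrDr mulrCA.
exact: H.
Qed.

End convolution.

Section operators.
Context {R : realType}.
Implicit Types (V W : normedModType R[i]).

Definition bounded_operator V W (T : {linear V -> W}) : Prop :=
  exists M : R[i], forall x, `|T x| <= M * `|x|.

Definition compact_operator V W (T : {linear V -> W}) : Prop :=
  forall A : set V, bounded_set A -> precompact (T @` A).

Definition commutator V (A B : {linear V -> V}) : {linear V -> V} :=
  (A \o B) \- (B \o A).

(* Linear in the first argument. *)
Definition l2_inner (f g : l2 R) : R[i]^o :=
  summability.sum (fun n : int => f n * (g n)^* : R[i]^o).

Definition orthonormal_basis (I : choiceType) (e : I -> l2 R) : Prop :=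
  (forall i j, l2_inner (e i) (e j) = (i == j)%:R) /\
  closure [set f : l2 R | exists (J : {fset I}) (c : I -> R[i]),
    f = \sum_(i <- J) c i *: e i] = setT.

Definition hilbert_schmidt (T : {linear l2 R -> l2 R}) : Prop :=
  bounded_operator T /\
  exists (I : choiceType) (e : I -> l2 R), orthonormal_basis e /\
    (\esum_(i in [set: I]) (l2norm (T (e i)) ^+ 2)%:E < +oo)%E.

Definition cutoff_fun (f : int -> R[i]^o) : int -> R[i]^o :=
  fun n => if 0 <= n then f n else 0.

Lemma cutoff_square_summable (f : l2 R) : cutoff_fun f \in square_summable.
Proof.
have [f0 fM] := l2bound_norm (l2P f).
have [//|//] := @l2boundP _ (cutoff_fun f) (l2norm f).
split=> // J; apply: le_trans (fM J); apply: ler_sum => n _.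
rewrite /cutoff_fun; case: ifP => // _.
by rewrite [normc 0]ComplexField.Normc.normc0 expr0n sqr_ge0.
Qed.

Definition cutoff_map (f : l2 R) : l2 R := L2 (cutoff_square_summable f).

Lemma cutoff_linear : linear cutoff_map.
Proof.
move=> c f g; apply/val_inj/funext => n /=.
rewrite -[RHS]/(c * cutoff_fun f n + cutoff_fun g n) /cutoff_fun.
by case: ifP => // _; rewrite mulr0 addr0.
Qed.

HB.instance Definition _ :=
  GRing.isLinear.Build R[i] (l2 R) (l2 R) _ cutoff_map cutoff_linear.

Definition cutoff : {linear l2 R -> l2 R} := cutoff_map.

Definition essentially_local (A : {linear l2 R -> l2 R}) : Prop :=
  bounded_operator A /\ compact_operator (commutator A cutoff).

End operators.

(* The vertex set is [int] and [n], [n + k] are joined by an edge of weight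
   [weight k] whenever [0 < weight k]. *)
Record periodic_graph (R : realType) := PeriodicGraph {
  weight : int -> R ;
  potential : R ;
  weight_ge0 : forall k, 0 <= weight k ;
  weight0 : weight 0 = 0 ;
  weightN : forall k, weight (- k) = weight k ;
  weight_summable : (\esum_(k in [set: int]) (weight k)%:E < +oo)%E ;
  graph_connected : forall n m : int, exists s : seq int,
    path (fun a b => 0 < weight (b - a)) n s /\ last n s = m }.

Section hamiltonian.
Context {R : realType} (G : periodic_graph R).

Lemma weight_partial_le (J : {fset int}) : \sum_(k <- J) weight G k <=
  fine (\esum_(k in [set: int]) (weight G k)%:E)%E.
Proof.
move: J; apply/esum_le_fset; rewrite fineK// ge0_fin_numE ?weight_summable//.
by apply: esum_ge0 => k _; rewrite lee_fin weight_ge0.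
Qed.

Definition hamiltonian_fun (f : int -> R[i]^o) : int -> R[i]^o :=
  fun n => convolution (weight G) f n + (potential G)%:C * f n.

Lemma hamiltonian_square_summable (f : l2 R) :
  hamiltonian_fun f \in square_summable.
Proof.
have fM := l2bound_norm (l2P f).
have cM := l2bound_convolution (weight_ge0 G) weight_partial_le fM.
have := l2bound_add cM (l2boundZ (potential G)%:C fM).
by move=> /l2boundP[].
Qed.

Definition hamiltonian_map (f : l2 R) : l2 R :=
  L2 (hamiltonian_square_summable f).

Lemma hamiltonian_linear : linear hamiltonian_map.
Proof.
move=> c f g; apply/val_inj/funext => n.
rewrite -[RHS]/(c * hamiltonian_fun f n + hamiltonian_fun g n).
rewrite -[LHS]/(convolution (weight G) (c *: (f : int -> R[i]^o) + g) n +
  (potential G)%:C * (c * f n + g n)).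
rewrite (convolution_linear (weight_ge0 G) weight_partial_le _ (l2P f) (l2P g)).
rewrite -[(_ + _) n]/(c * convolution (weight G) f n +
  convolution (weight G) g n) /hamiltonian_fun.
by ring.
Qed.

HB.instance Definition _ :=
  GRing.isLinear.Build R[i] (l2 R) (l2 R) _ hamiltonian_map hamiltonian_linear.

Definition hamiltonian : {linear l2 R -> l2 R} := hamiltonian_map.

(* Non-strictly decreasing. *)
Definition weight_decreasing : Prop :=
  forall j k : int, j != 0 -> k != 0 -> `|j| <= `|k| -> weight G k <= weight G j.

Definition weight_sup_summable : Prop :=
  (\sum_(1 <= k <oo)
     ereal_sup [set (weight G n%:Z)%:E | n in [set n | (k <= n)%N]] < +oo)%E.

End hamiltonian.

(* Main.v *)
(* The matrix of the commutator T has entry w(m - n), up to sign, when n and m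
   lie on opposite sides of the cut, and 0 otherwise.  If |n| > K, only the
   weights w(k) with |k| > K contribute to (T f)(n), so by Young's inequality
   the tails of T f are uniformly small for f in a ball; a bounded set of
   sequences with uniformly small tails is precompact in l^2.  Counting the
   entries on each diagonal, the squared Hilbert-Schmidt norm of T is
   2 sum_(k >= 1) k w(k)^2.  Under either condition of (b), k w(k) is bounded
   by a constant C, and the sum is at most C ||w||_1.  The summable weight
   w(+-4^j) = 2^-j has k w(k)^2 = 1 for every k = 4^j, so the sum diverges. *)

Require Import Defs.
From HB Require Import structures.
From mathcomp Require Import all_boot all_order all_algebra finmap complex.
From mathcomp Require Import all_classical all_reals.
From mathcomp Require Import ereal topology normedtype sequences esum.
From mathcomp Require summability.
From mathcomp Require Import ring lra zify.

Set Implicit Arguments.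
Unset Strict Implicit.
Unset Printing Implicit Defensive.

Import Order.TTheory GRing.Theory Num.Theory numFieldNormedType.Exports.
Local Open Scope classical_set_scope.
Local Open Scope ring_scope.
Local Open Scope complex_scope.

Import summability.

(** * Finite sums of nonnegative families and their tails *)

Lemma sum_fset_uniq {R : realType} {I : choiceType} (a : I -> R) (s : seq I) :
  uniq s -> \sum_(i <- s) a i = \sum_(i <- seq_fset tt s) a i.
Proof.
move=> us; apply: perm_big; apply: uniq_perm => // i.
by rewrite -[RHS]/(i \in seq_fset tt s) seq_fsetE.
Qed.

Lemma sum_fset_sub {R : realType} {I : choiceType} (a : I -> R)
    (A B : {fset I}) : (forall i, 0 <= a i) -> (A `<=` B)%fset ->
  \sum_(i <- A) a i <= \sum_(i <- B) a i.
Proof.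
move=> a0 AB; rewrite [leRHS](big_fsetID _ [in A])/=.
have -> : [fset x in B | x \in A]%fset = A.
  apply/fsetP => i; rewrite !inE andbC.
  by case: (boolP (i \in A)) => //= /(fsubsetP AB).
by rewrite lerDl sumr_ge0.
Qed.

(** Choose [J0] whose sum is within [e] of the supremum of all finite sums. A disjoint [J] adds its
    sum to that of [J0], and the total cannot exceed the supremum. *)
Lemma fset_tail {R : realType} {I : choiceType} (a : I -> R) (M e : R) :
    (forall i, 0 <= a i) -> (forall J : {fset I}, \sum_(i <- J) a i <= M) ->
    0 < e ->
  exists J0 : {fset I}, forall J : {fset I}, [disjoint J0 & J]%fset ->
    \sum_(i <- J) a i <= e.
Proof.
move=> a0 aM e0; pose E := range (fun J : {fset I} => \sum_(i <- J) a i).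
have supE : has_sup E.
  by split; [exists (\sum_(i <- fset0) a i), fset0 | exists M => _ [J _ <-]].
have [_ [J0 _ <-] ltJ0] := sup_adherent e0 supE.
exists J0 => J J0J; have leE : \sum_(i <- (J0 `|` J)%fset) a i <= sup E.
  by apply: (sup_upper_bound supE); exists (J0 `|` J)%fset.
have : \sum_(i <- (J0 `|` J)%fset) a i =
    \sum_(i <- J0) a i + \sum_(i <- J) a i.
  rewrite (big_fsetID _ [in J0])/=; congr (_ + _); congr bigop.
    apply: congr1; apply/fsetP => i; rewrite !inE.
    by case: (i \in J0); rewrite ?andbF.
  apply: congr1; apply/fsetP => i; rewrite !inE.
  have /fdisjointP/(_ i) := J0J.
  by case: (i \in J0) => [/(_ isT)/negPf->//|_]; rewrite ?andbT.
lra.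
Qed.

(** * Precompactness in l2 *)

Section ultrafilter_limits.
Context {R : realType} {T : Type} (F : set_system T) {FU : UltraFilter F}.
Let FP : ProperFilter F := ultra_proper.
#[local] Existing Instance FP.

(** Compactness of the segment from [-M] to [M] yields a cluster point of the image filter, and an
    ultrafilter converges to each of its cluster points. *)
Lemma ultra_cvg_bounded (h : T -> R) (M : R) :
  F [set x | `|h x| <= M] -> exists p : R, h x @[x --> F] --> p.
Proof.
move=> hM; have hM' : fmap h F `[- M, M]%classic.
  by apply: (@filterS T F _ _ _ _ hM) => x; rewrite /= in_itv/= ler_norml.
have [p [_ pC]] := segment_compact (fmap_proper_filter h FP) hM'.
exists p; apply/cvgrPdist_lt => e e0.
have [//|FN] := in_ultra_setVsetC [set x | `|p - h x| < e] FU.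
have [y []] := pC [set y | ~ `|p - y| < e] (ball p e) FN (nbhsx_ballx p e e0).
by rewrite /ball/=.
Qed.

Lemma ultra_cvg_normc (h : T -> R[i]) (M : R) :
    F [set x | normc (h x) <= M] ->
  exists p, normc (p - h x) @[x --> F] --> (0 : R).
Proof.
move=> hM.
have [|a ca] := @ultra_cvg_bounded (fun x => complex.Re (h x)) M.
  apply: filterS hM => x; apply: le_trans.
  exact: (ReIm_le_normc (h x)).1.
have [|b cb] := @ultra_cvg_bounded (fun x => complex.Im (h x)) M.
  apply: filterS hM => x; apply: le_trans.
  exact: (ReIm_le_normc (h x)).2.
exists (a +i* b).
have cab : `|a - complex.Re (h x)| + `|b - complex.Im (h x)| @[x --> F]
    --> (0 : R).
  rewrite -[0]addr0; apply: cvgD; rewrite -[0](@normr0 _ R).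
    by rewrite -(subrr a); apply: cvg_norm; apply: cvgB => //; exact: cvg_cst.
  by rewrite -(subrr b); apply: cvg_norm; apply: cvgB => //; exact: cvg_cst.
apply: squeeze_cvgr (cvg_cst 0) cab; apply: nearW => x.
rewrite normc_ge0/=; have := normc_le_ReIm (a +i* b - h x).
by case: (h x).
Qed.

End ultrafilter_limits.

Lemma cvg_normc {R : realType} {T : Type} (F : set_system T) {FF : Filter F}
    (h : T -> R[i]) (p : R[i]) :
  normc (p - h x) @[x --> F] --> (0 : R) ->
  normc (h x) @[x --> F] --> normc p.
Proof.
move=> /cvgrPdist_lt hp; apply/cvgrPdist_lt => e e0.
apply: filterS (hp e e0) => x.
rewrite sub0r normrN [X in X < _ -> _]ger0_norm ?normc_ge0//.
exact/le_lt_trans/normc_dist.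
Qed.

Lemma cvg_sum_seq {R : realType} {T : Type} {I : Type} (F : set_system T)
    {FF : Filter F} (s : seq I) (h : I -> T -> R) (p : I -> R) :
  (forall i, h i x @[x --> F] --> p i) ->
  \sum_(i <- s) h i x @[x --> F] --> \sum_(i <- s) p i.
Proof.
move=> hp; elim: s => [|i s IH].
  by rewrite big_nil; under eq_fun do rewrite big_nil; exact: cvg_cst.
by rewrite big_cons; under eq_fun do rewrite big_cons; exact: cvgD.
Qed.

Lemma cvg_sqr {R : realType} {T : Type} (F : set_system T) {FF : Filter F}
    (h : T -> R) (p : R) :
  h x @[x --> F] --> p -> h x ^+ 2 @[x --> F] --> p ^+ 2.
Proof. by move=> hp; rewrite expr2; exact: cvgM. Qed.

Section l2_compactness.
Context {R : realType}.
Implicit Types (f g : l2 R) (J A : {fset int}).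

Lemma l2bound_dominated (f g : int -> R[i]^o) (M : R) :
  (forall n, normc (g n) <= normc (f n)) -> l2bound f M -> l2bound g M.
Proof.
move=> gf [M0 fM]; split=> // J; apply: le_trans (fM J).
by apply: ler_sum => n _; rewrite ler_pXn2r ?nnegrE ?normc_ge0.
Qed.

Lemma l2_normE f : `|f| = (l2norm f)%:C. Proof. by []. Qed.

Lemma normc_sqrB_le (x y : R[i]) :
  normc (x - y) ^+ 2 <= 2 * normc x ^+ 2 + 2 * normc y ^+ 2.
Proof.
have := normc_triangle x (- y); rewrite [normc (- y)](@normcN R).
have := normc_ge0 (x - y).
set a := normc _; set b := normc _; set c := normc _ => a0 abc.
by have := sqr_ge0 (b - c); nra.
Qed.

(** An ultrafilter on this set converges in every coordinate. The norm bound and the tail bounds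
    involve only finite sums, so they pass to the limit. The common tail bounds then upgrade
    coordinatewise convergence to norm convergence. *)
Lemma l2_ball_compact (M : R) (J : R -> {fset int}) :
  compact [set f : l2 R | l2bound f M /\
    forall e, 0 < e -> forall A, [disjoint J e & A]%fset ->
      \sum_(n <- A) normc (f n) ^+ 2 <= e].
Proof.
set K := [set f | _]; rewrite compact_ultra => F FU FK.
have FP : ProperFilter F by exact: ultra_proper.
have coord n : exists p, (fun f : l2 R => normc (p - f n)) @ F --> (0 : R).
  apply: (@ultra_cvg_normc _ _ _ FU _ M).
  by apply: filterS FK => f [fM _]; exact: l2bound_eval fM.
have {coord}[g0 g0P] := choice coord.
have sum_cvg A : (fun f : l2 R => \sum_(n <- A) normc (f n) ^+ 2) @ F -->
    \sum_(n <- A) normc (g0 n) ^+ 2.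
  by apply: cvg_sum_seq => n; apply: cvg_sqr; apply: cvg_normc; exact: g0P.
have sum_le A c : (forall f, K f -> \sum_(n <- A) normc (f n) ^+ 2 <= c) ->
    \sum_(n <- A) normc (g0 n) ^+ 2 <= c.
  move=> Kc; rewrite -(cvg_lim _ (sum_cvg A))//.
  apply: limr_le; first by apply/cvg_ex; eexists; exact: sum_cvg.
  by apply: (@filterS _ F _ _ _ _ FK) => f; exact: Kc.
have [f0 [[M0 _] _]] := @filter_ex _ F FP _ FK.
have g0M : l2bound g0 M.
  by split=> // A; apply: sum_le => f [[_]].
pose g := L2 (l2boundP g0M).1; exists g.
have Kg : K g.
  by split=> // e e0 A dA; apply: sum_le => f [_ /(_ e e0 A dA)].
split=> //=; apply/cvgrPdist_lt => e e0.
(* The norm of [l2 R] takes values in [R[i]], so the radius is a positive complex number and is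
   replaced by its real part. *)
have eE : e = (complex.Re e)%:C by rewrite RRe_real// gtr0_real.
have {}e0 : 0 < complex.Re e by rewrite -ltcR -eE.
rewrite eE; move: (complex.Re e) e0 => {eE}{}e e0.
(* The squared distance is at most [d] on [J d] and at most [2 * d + 2 * d] off it, hence
   [5 * d = (e / 2) ^+ 2] in all. *)
pose d := e ^+ 2 / 20; have d0 : 0 < d by rewrite divr_gt0// exprn_gt0.
have sumB_cvg : (fun f : l2 R => \sum_(n <- J d) normc (g n - f n) ^+ 2) @ F
    --> (0 : R).
  have sum0 : \sum_(n <- J d) 0 ^+ 2 = 0 :> R.
    by rewrite big1// => n _; rewrite expr0n.
  rewrite -[X in _ --> X]sum0.
  exact: (cvg_sum_seq (s := J d) (fun n => cvg_sqr (g0P n))).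
have nearJ : F [set f : l2 R | \sum_(n <- J d) normc (g n - f n) ^+ 2 <= d].
  have /cvgrPdist_lt/(_ d d0) := sumB_cvg; apply: filterS => f.
  by rewrite sub0r normrN => /(le_lt_trans (ler_norm _))/ltW.
near=> f; rewrite l2_normE ltcR.
have fK : K f by near: f.
suff /l2boundP[_ /le_lt_trans->//] : l2bound (g - f) (e / 2) by lra.
split=> [|A]; first by rewrite divr_ge0// ltW.
rewrite -[leLHS]/(\sum_(n <- A) normc (g n - f n) ^+ 2).
rewrite (big_fsetID _ [in J d])/=.
have : \sum_(n <- [fset x in A | x \in J d]%fset) normc (g n - f n) ^+ 2 <= d.
  apply: le_trans (_ : _ <= \sum_(n <- J d) normc (g n - f n) ^+ 2) _; last first.
    by near: f.
  apply: sum_fset_sub => [n|]; first exact: sqr_ge0.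
  by apply/fsubsetP => n; rewrite !inE => /andP[].
set B := [fset x in A | x \notin J d]%fset.
have dB : [disjoint J d & B]%fset.
  by apply/fdisjointP => n nJ; rewrite !inE nJ andbF.
have : \sum_(n <- B) normc (g n - f n) ^+ 2 <=
    2 * (\sum_(n <- B) normc (g n) ^+ 2) + 2 * (\sum_(n <- B) normc (f n) ^+ 2).
  rewrite !mulr_sumr -big_split/=; apply: ler_sum => n _.
  exact: normc_sqrB_le.
have := fK.2 d d0 B dB; have := Kg.2 d d0 B dB.
rewrite /d; nra.
Unshelve. all: by end_near. Qed.

Lemma l2_precompact (B : set (l2 R)) (M : R) :
    (forall f, B f -> l2bound f M) ->
    (forall e : R, 0 < e -> exists J, forall f, B f ->
      forall A, [disjoint J & A]%fset -> \sum_(n <- A) normc (f n) ^+ 2 <= e) ->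
  precompact B.
Proof.
move=> BM tail.
have /choice[J JP] (e : R) : exists J, 0 < e -> forall f, B f ->
    forall A, [disjoint J & A]%fset -> \sum_(n <- A) normc (f n) ^+ 2 <= e.
  have [/tail[J JP]|] := ltP 0 e; first by exists J.
  (* Default value for [e <= 0], where nothing is required. *)
  by exists fset0.
apply: precompact_subset (compact_precompact (@norm_hausdorff _ _)
  (@l2_ball_compact M J)) => f Bf; split; first exact: BM.
by move=> e e0 A; exact: JP.
Qed.

End l2_compactness.

(** * The commutator with the cutoff *)

Section commutator_with_cutoff.
Context {R : realType} (G : periodic_graph R).
Let w := weight G.
Let W := fine (\esum_(k in [set: int]) (w k)%:E)%E.
Let T := commutator (hamiltonian G) cutoff.
Let w_ge0 : forall k, 0 <= w k := @weight_ge0 R G.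
Let w_le : forall J : {fset int}, \sum_(k <- J) w k <= W := weight_partial_le G.

(** The part of [f] across the cut from [n]. It depends on [n] only through its sign, so only
    [far_half 0 f] and [far_half (-1) f] ever occur. *)
Definition far_half (n : int) (f : int -> R[i]^o) : int -> R[i]^o :=
  fun m => if (0 <= n) == (0 <= m) then 0 else f m.

Lemma normc_far_half n (f : int -> R[i]^o) m :
  normc (far_half n f m) <= normc (f m).
Proof.
rewrite /far_half; case: ifP => // _.
by rewrite [normc 0]ComplexField.Normc.normc0 normc_ge0.
Qed.

Lemma l2bound_far_half n (f : int -> R[i]^o) M :
  l2bound f M -> l2bound (far_half n f) M.
Proof. by apply: l2bound_dominated => m; exact: normc_far_half. Qed.

(** For [n >= 0] the potential terms cancel and subtracting the convolution of [f] from that of its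
    cutoff leaves minus the far half. For [n < 0] the second product vanishes at [n] and the cutoff
    of [f] is the far half. Taking moduli hides the sign. *)
Lemma normc_commutator (f : l2 R) n :
  normc (T f n) = normc (convolution w (far_half n f) n).
Proof.
have fP := l2bound_norm (l2P f).
have -> : T f n = hamiltonian_fun G (cutoff_fun f) n -
  cutoff_fun (hamiltonian_fun G f) n by [].
have [n0|n0] := leP 0 n.
  have cutE h : cutoff_fun h n = h n :> R[i] by rewrite /cutoff_fun n0.
  have fE : far_half n f + cutoff_fun f = f.
    apply/funext => m; rewrite -[LHS]/(far_half n f m + cutoff_fun f m).
    by rewrite /far_half /cutoff_fun n0; case: (0 <= m); rewrite ?add0r ?addr0.
  have := convolution_linear w_ge0 w_le 1 (l2boundP (l2bound_far_half n fP)).1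
    (cutoff_square_summable f).
  rewrite !scale1r fE => convE.
  have {convE}-> : convolution w (far_half n f) n =
    convolution w f n - convolution w (cutoff_fun f) n by rewrite convE addrK.
  rewrite cutE /hamiltonian_fun cutE -/w opprD addrACA subrr addr0.
  by rewrite -opprB; exact: normcN.
have cut0 h : cutoff_fun h n = 0 :> R[i] by rewrite /cutoff_fun [0 <= n]leNgt n0.
have cutE : cutoff_fun f = far_half n f.
  apply/funext => m; rewrite /far_half /cutoff_fun [0 <= n]leNgt n0.
  by case: (0 <= m).
by rewrite cut0 /hamiltonian_fun cut0 subr0 mulr0 addr0 cutE.
Qed.

(** On each side of the cut, [T f] has the modulus of one fixed convolution. The squares of both
    convolutions are summed over all of [J], and Young's inequality bounds each sum by
    [(W * M) ^+ 2]. *)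
Lemma l2bound_commutator (f : l2 R) M :
  l2bound f M -> l2bound (T f) ((W + W) * M).
Proof.
move=> fM.
have cM m := l2bound_convolution w_ge0 w_le (l2bound_far_half m fM).
rewrite mulrDl; have [WM0 _] := cM 0.
split=> [|J]; first by rewrite addr_ge0.
apply: (@le_trans _ _ (\sum_(n <- J) (normc (convolution w (far_half 0 f) n) ^+ 2 +
    normc (convolution w (far_half (-1) f) n) ^+ 2))).
  apply: ler_sum => n _; rewrite normc_commutator.
  have [n0|n0] := leP 0 n.
    have -> : far_half n f = far_half 0 f by rewrite /far_half n0 lexx.
    by rewrite lerDl sqr_ge0.
  have -> : far_half n f = far_half (-1) f by rewrite /far_half [0 <= n]leNgt n0.
  by rewrite lerDr sqr_ge0.
rewrite big_split/=; have := (cM 0).2 J; have := (cM (-1)).2 J; nra.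
Qed.

Lemma bounded_operator_l2 (S : {linear l2 R -> l2 R}) (C : R) :
  (forall (f : l2 R) M, l2bound f M -> l2bound (S f) (C * M)) -> bounded_operator S.
Proof.
move=> SC; exists C%:C => f; rewrite !l2_normE -rmorphM lecR.
by have /SC/l2boundP[] := l2bound_norm (l2P f).
Qed.

Lemma bounded_hamiltonian : bounded_operator (hamiltonian G).
Proof.
apply: (@bounded_operator_l2 _ (W + normc (potential G)%:C)) => f M fM.
rewrite mulrDl; apply: l2bound_add (l2boundZ _ fM).
exact: l2bound_convolution.
Qed.

Lemma bounded_commutator : bounded_operator T.
Proof. exact: bounded_operator_l2 l2bound_commutator. Qed.

End commutator_with_cutoff.

(** * Uniformly small tails and compactness of the commutator *)

Lemma int_ball_fset (K : nat) : exists J : {fset int},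
  forall n : int, n \notin J -> (K < `|n|)%N.
Proof.
exists (seq_fset tt [seq i%:Z - K%:Z | i <- iota 0 (K + K).+1]) => n.
rewrite seq_fsetE; apply: contraR; rewrite -leqNgt => nK.
by apply/mapP; exists (absz (n + K%:Z)); rewrite ?mem_iota; lia.
Qed.

Lemma fset_int_bounded (J : {fset int}) :
  exists K : nat, forall k : int, k \in J -> (`|k| <= K)%N.
Proof.
exists (\max_(k <- J) `|k|%N) => k kJ.
exact: (@leq_bigmax_seq _ _ xpredT (fun k : int => `|k|%N)) kJ isT.
Qed.

Section compact_commutator.
Context {R : realType} (G : periodic_graph R).
Let w := weight G.
Let T := commutator (hamiltonian G) cutoff.

(** Far from the cut only long edges cross it. There [w] may be replaced by its restriction [w'] to
    the complement of a finite set, whose total mass is at most [d], and Young's inequality applies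
    with [d] in place of the full mass. *)
Lemma commutator_tail (M e : R) : 0 < e -> exists J : {fset int},
  forall f : l2 R, l2bound f M -> forall A, [disjoint J & A]%fset ->
    \sum_(n <- A) normc (T f n) ^+ 2 <= e.
Proof.
(* As [d <= 1], [2 * (d * M) ^+ 2 <= d * (2 * (M ^+ 2 + 1)) <= e]; the added 1 keeps the denominator
   positive when [M = 0]. *)
move=> e0; pose d := Num.min 1 (e / (2 * (M ^+ 2 + 1))).
have M2 : 0 < 2 * (M ^+ 2 + 1) by have := sqr_ge0 M; lra.
have d0 : 0 < d by rewrite lt_min ltr01 divr_gt0.
have dM : (d * M) ^+ 2 + (d * M) ^+ 2 <= e.
  have d1 : d <= 1 by rewrite ge_min lexx.
  have : d * (2 * (M ^+ 2 + 1)) <= e by rewrite -ler_pdivlMr// ge_min lexx orbT.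
  have := sqr_ge0 M; rewrite exprMn; nra.
have [J0 J0P] := fset_tail (weight_ge0 G) (weight_partial_le G) d0.
have [K KP] := fset_int_bounded J0; have [J JP] := int_ball_fset K.
exists J => f fM A JA.
pose w' k := if k \in J0 then 0 else w k.
have w'_ge0 k : 0 <= w' k by rewrite /w'; case: ifP => // _; exact: weight_ge0.
have w'_le (B : {fset int}) : \sum_(k <- B) w' k <= d.
  rewrite (big_fsetID _ [in J0])/= [X in X + _]big_seq big1 ?add0r.
    rewrite (@eq_big_seq _ _ _ _ _ _ w).
      by apply: J0P; apply/fdisjointP => k kJ0; rewrite !inE kJ0 andbF.
    by move=> k; rewrite !inE /w' => /andP[_ /negPf->].
  by move=> k; rewrite !inE /w' => /andP[_ ->].
have cM m := l2bound_convolution w'_ge0 w'_le (l2bound_far_half m fM).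
apply: le_trans dM.
apply: (@le_trans _ _ (\sum_(n <- A) (normc (convolution w' (far_half 0 f) n) ^+ 2 +
    normc (convolution w' (far_half (-1) f) n) ^+ 2))); last first.
  by rewrite big_split/= lerD//; [exact: (cM 0).2 | exact: (cM (-1)).2].
rewrite big_seq [leRHS]big_seq; apply: ler_sum => n nA.
have /JP Kn : n \notin J by apply: contraL nA; exact: (fdisjointP JA).
(* The weights [w] and [w'] differ only at [k] in [J0], where [|k| <= K < |n|]. Then [n + k] lies on
   the same side as [n], and [far_half n f] vanishes there. *)
have -> : normc (T f n) = normc (convolution w' (far_half n f) n).
  rewrite normc_commutator; congr normc.
  apply: (congr1 (@summability.sum _ _ R[i]^o)).
  apply/funext => k; rewrite /w'; case: ifPn => [/KP kK|_]; last by [].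
  by rewrite /far_half (_ : _ == _) ?mulr0//; lia.
have [n0|n0] := leP 0 n.
  have -> : far_half n f = far_half 0 f by rewrite /far_half n0 lexx.
  by rewrite lerDl sqr_ge0.
have -> : far_half n f = far_half (-1) f.
  by rewrite /far_half [0 <= n]leNgt n0.
by rewrite lerDr sqr_ge0.
Qed.

Lemma compact_commutator : compact_operator T.
Proof.
move=> B /pinfty_ex_gt0[M M0 BM].
have BM' f : B f -> l2bound f (complex.Re M).
  move=> /BM; rewrite /= l2_normE [M](_ : _ = (complex.Re M)%:C).
    by rewrite lecR => /l2bound_le; apply; exact/l2bound_norm/l2P.
  by rewrite RRe_real// gtr0_real.
apply: (@l2_precompact _ _ (_ * complex.Re M)) => [_ [f /BM' fM <-]|e e0].
  exact: l2bound_commutator.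
have [J JP] := @commutator_tail (complex.Re M) e e0.
by exists J => _ [f /BM' fM <-] A; exact: JP.
Qed.

End compact_commutator.

(** * Hilbert-Schmidt norm in the canonical basis *)

(** The net of partial sums is constant from the singleton of [i] on. *)
Lemma sum_single {R : realType} {I : choiceType} (x : I -> R[i]^o) (i : I) :
  (forall j, j != i -> x j = 0) -> summability.sum x = x i.
Proof.
move=> x0; apply: lim_near_cst; first exact: norm_hausdorff.
exists [fset i]%fset => // J /=; rewrite fsub1set => iJ.
rewrite partial_sumE (big_fsetD1 i)//= big_seq big1 ?addr0// => j.
by rewrite !inE => /andP[/x0].
Qed.

Lemma l2_closureP {R : realType} (B : set (l2 R)) (f : l2 R) :
  closure B f <-> forall e : R, 0 < e -> exists2 g, B g & l2norm (f - g) < e.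
Proof.
have ballE (e : R) g : ball f e%:C g = (l2norm (f - g) < e) :> Prop.
  by rewrite -ball_normE/= l2_normE ltcR.
split=> [Bf e e0|Bf U].
  have eC : 0 < e%:C by rewrite ltcR.
  have [g [Bg]] := Bf _ (nbhsx_ballx f _ eC).
  by rewrite ballE; exists g.
move=> /nbhs_ballP[e /= e0 eU].
have eE : e = (complex.Re e)%:C by rewrite RRe_real// gtr0_real.
have /Bf[g Bg fg] : 0 < complex.Re e by rewrite -ltcR -eE.
by exists g; split=> //; apply: eU; rewrite eE ballE.
Qed.

Lemma sum_eq_le1 {R : realType} {I : choiceType} (i : I) (J : {fset I}) :
  \sum_(n <- J) (n == i)%:R <= 1 :> R.
Proof.
apply: (@le_trans _ _ (\sum_(n <- (i |` J)%fset) (n == i)%:R)).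
  by apply: sum_fset_sub => [n|]; [exact: ler0n | exact: fsubsetU1].
rewrite (big_fsetD1 i) ?fset1U1//= eqxx big_seq big1 ?addr0// => n.
by rewrite !inE => /andP[/negPf->].
Qed.

Section canonical_basis.
Context {R : realType}.

Definition delta (i : int) : int -> R[i]^o := fun n => (n == i)%:R.

Lemma normc_nat_bool (b : bool) : normc (b%:R : R[i]) = b%:R.
Proof.
case: b => /=; last exact: ComplexField.Normc.normc0.
exact: ComplexField.Normc.normc1.
Qed.

Lemma l2bound_delta i : l2bound (delta i) 1.
Proof.
split=> // J; rewrite expr1n; apply: le_trans (sum_eq_le1 i J).
apply: ler_sum => n _; rewrite /delta normc_nat_bool.
by case: (n == i); rewrite ?expr1n ?expr0n.
Qed.

Definition l2_delta i : l2 R := L2 (l2boundP (l2bound_delta i)).1.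

Lemma l2_sumE {I : Type} (s : seq I) (F : I -> l2 R) n :
  (\sum_(i <- s) F i) n = \sum_(i <- s) F i n :> R[i].
Proof.
elim: s => [|i s IH]; first by rewrite !big_nil.
rewrite !big_cons -IH; exact: erefl.
Qed.

(** Each inner product has at most one nonzero term. For density, [f] is truncated to a finite set
    off which its squared mass is at most [(e / 2) ^+ 2]; halving [e] makes the final inequality
    strict. *)
Lemma delta_basis : orthonormal_basis l2_delta.
Proof.
split=> [i j|].
  rewrite /l2_inner (@sum_single _ _ _ i) => [|n /negPf ni].
    by rewrite /= /delta eqxx mul1r; case: (i == j); rewrite ?rmorph1 ?rmorph0.
  by rewrite /= /delta ni mul0r.
rewrite -subTset => f _; apply/l2_closureP => e e0.
have [f0 fM] := l2bound_norm (l2P f).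
have e2 : 0 < (e / 2) ^+ 2 by rewrite exprn_gt0// divr_gt0.
have [J JP] := fset_tail (fun n => sqr_ge0 (normc (f n))) fM e2.
exists (\sum_(i <- J) f i *: l2_delta i); first by exists J, f.
suff /l2boundP[_ /le_lt_trans->//] :
  l2bound (f - \sum_(i <- J) f i *: l2_delta i) (e / 2) by lra.
split=> [|A]; first by rewrite divr_ge0// ltW.
apply: le_trans (JP [fset n in A | n \notin J]%fset _); last first.
  by apply/fdisjointP => n nJ; rewrite !inE nJ andbF.
rewrite (big_fsetID _ [in J])/= [X in X + _]big_seq big1 ?add0r.
  rewrite big_seq [leRHS]big_seq; apply: ler_sum => n; rewrite !inE => /andP[_ nJ].
  rewrite -[X in normc X]/(f n - (\sum_(i <- J) f i *: l2_delta i) n) l2_sumE.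
  rewrite big_seq big1 ?subr0// => i iJ.
  rewrite -[LHS]/(f i * delta i n) /delta; case: eqP => [ni|]; rewrite ?mulr0//.
  by rewrite ni iJ in nJ.
move=> n; rewrite !inE => /andP[_ nJ].
rewrite -[X in normc X]/(f n - (\sum_(i <- J) f i *: l2_delta i) n) l2_sumE.
rewrite (big_fsetD1 n)//= big_seq big1 => [|i]; last first.
  rewrite !inE eq_sym => /andP[/negPf ni _].
  by rewrite -[LHS]/(f i * delta i n) /delta ni mulr0.
rewrite addr0 -[X in _ - X]/(f n * delta n n) /delta eqxx mulr1 subrr.
by rewrite [normc _]ComplexField.Normc.normc0 expr0n.
Qed.

End canonical_basis.

(** Tonelli for nonnegative families: both sides are sums over pairs, matched by swapping the
    components. *)
Lemma esum_exchange {R : realType} {I J : choiceType} (a : I -> J -> \bar R) :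
    (forall i j, 0 <= a i j)%E ->
  (\esum_(i in setT) \esum_(j in setT) a i j =
   \esum_(j in setT) \esum_(i in setT) a i j)%E.
Proof.
move=> a0; rewrite !esum_esum//.
by apply: (reindex_esum _ _ (fun p : J * I => (p.2, p.1))); split => [||[i j]];
  [ | move=> [? ?] [? ?] _ _ /= [-> ->] | exists (j, i)].
Qed.

(** * A Hilbert-Schmidt criterion from the matrix entries *)

Section hilbert_schmidt_commutator.
Context {R : realType} (G : periodic_graph R).
Let w := weight G.
Let W := fine (\esum_(k in [set: int]) (w k)%:E)%E.
Let T := commutator (hamiltonian G) cutoff.
Let w_ge0 : forall k, 0 <= w k := @weight_ge0 R G.
Let w_le : forall J : {fset int}, \sum_(k <- J) w k <= W := weight_partial_le G.

(** Only the term [k = i - n] of the convolution survives; this is the matrix entry in row [n] and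
    column [i]. *)
Lemma normc_commutator_delta i n : normc (T (l2_delta i) n) =
  if (0 <= n) == (0 <= i) then 0 else w (i - n).
Proof.
rewrite normc_commutator /convolution (@sum_single _ _ _ (i - n)) => [|k].
  rewrite ComplexField.Normc.normcM normc_real// [n + _]addrC subrK /far_half.
  case: ifP => _; first by rewrite [normc _]ComplexField.Normc.normc0 mulr0.
  by rewrite /= /delta eqxx [normc _]ComplexField.Normc.normc1 mulr1.
move=> ki; rewrite /far_half; case: ifP; rewrite ?mulr0//= => _.
rewrite /delta (_ : (n + k == i) = false) ?mulr0//.
by apply: contraNF ki => /eqP <-; rewrite addrC addKr.
Qed.

(* The [m] for which [m] and [m - k] lie on different sides of the cut are
   [min(k, 0), ..., min(k, 0) + |k| - 1]. *)
Lemma sum_crossing_le (k : int) (J : {fset int}) (c : R) : 0 <= c ->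
  \sum_(m <- J) (if (0 <= m - k) == (0 <= m) then 0 else c) <= `|k|%N%:R * c.
Proof.
move=> c0; pose P m := (0 <= m - k) != (0 <= m).
rewrite (eq_bigr (fun m => if P m then c else 0)); last first.
  by move=> m _; rewrite /P; case: (_ == _).
rewrite -big_mkcond/= big_const_seq iter_addr_0 -[leLHS]mulr_natl ler_wpM2r//.
rewrite ler_nat -size_filter.
rewrite -[leqRHS](size_iota 0) -(size_map (fun i : nat => Num.min k 0 + i%:Z)).
apply: uniq_leq_size; first by rewrite filter_uniq// fset_uniq.
move=> m; rewrite mem_filter /P => /andP[km _].
by apply/mapP; exists (absz (m - Num.min k 0)); rewrite ?mem_iota; lia.
Qed.

(** The diagonal [i - n = k] has at most [|k|] entries across the cut, each of modulus [w k]. It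
    contributes at most [|k| * w k ^+ 2 <= C * w k], which is summable. *)
Lemma hilbert_schmidt_commutator (C : R) :
  (forall k, `|k|%N%:R * w k <= C) -> hilbert_schmidt T.
Proof.
move=> wC; split; first exact: bounded_commutator.
exists int, l2_delta; split; first exact: delta_basis.
have C0 : 0 <= C by apply: le_trans (wC 0); rewrite mul0r.
pose a (n i : int) := if (0 <= n) == (0 <= i) then 0 else w (i - n).
have a2 n i : (0 <= (a n i ^+ 2)%:E)%E by rewrite lee_fin sqr_ge0.
apply: (@le_lt_trans _ _ (\esum_(i in setT) \esum_(n in setT) (a n i ^+ 2)%:E)%E).
  apply: le_esum => i _; rewrite -square_summableE ?l2P//.
  by apply: le_esum => n _; rewrite normc_commutator_delta.
(* The substitution [n = i - k] makes [k] the index of the diagonal. *)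
have -> : (\esum_(i in setT) \esum_(n in setT) (a n i ^+ 2)%:E =
    \esum_(i in setT) \esum_(k in setT) (a (i - k) i ^+ 2)%:E)%E.
  apply: eq_esum => i _; apply: reindex_esum; split => //.
    by move=> x y _ _ /addrI/oppr_inj.
  by move=> n _; exists (i - n) => //; rewrite subKr.
rewrite esum_exchange//.
apply: (@le_lt_trans _ _ (\esum_(k in setT) (C * w k)%:E)%E).
  apply: le_esum => k _; apply/esum_le_fset => J.
  rewrite (eq_bigr (fun i => if (0 <= i - k) == (0 <= i) then 0 else w k ^+ 2)).
    apply: le_trans (sum_crossing_le _ _ (sqr_ge0 _)) _.
    by rewrite expr2 mulrA ler_wpM2r.
  by move=> i _; rewrite /a subKr; case: ifP; rewrite ?expr0n.
apply: (@le_lt_trans _ _ (C * W)%:E); last exact: ltry.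
by apply/esum_le_fset => J; rewrite -mulr_sumr ler_wpM2l.
Qed.

End hilbert_schmidt_commutator.

(** * Either decay condition bounds [|k| * w k] *)

Section weight_decay.
Context {R : realType} (G : periodic_graph R).
Let w := weight G.
Let W := fine (\esum_(k in [set: int]) (w k)%:E)%E.

(** Each of the [|k|] weights at [1, ..., |k|] is at least [w k], and their sum is at most [W]. *)
Lemma weight_decreasing_bound : weight_decreasing G ->
  forall k : int, `|k|%N%:R * w k <= W.
Proof.
move=> wdec k; have W0 : 0 <= W.
  by have := weight_partial_le G fset0; rewrite big_seq_fset0.
pose r := [seq i%:Z | i <- index_iota 1 `|k|.+1].
have ur : uniq r by rewrite map_inj_uniq ?iota_uniq// => i j [].
apply: le_trans (weight_partial_le G (seq_fset tt r)).
rewrite -sum_fset_uniq// big_map mulr_natl -[X in _ *+ X]subn0 -subSS.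
rewrite -sumr_const_nat [leLHS]big_nat [leRHS]big_nat.
by apply: ler_sum => i ik; apply: wdec; lia.
Qed.

(** Each of the first [|k|] suprema in the series is at least [w k], so the sum [S] of the series
    serves as the constant. *)
Lemma weight_sup_summable_bound : weight_sup_summable G ->
  exists C, forall k : int, `|k|%N%:R * w k <= C.
Proof.
rewrite /weight_sup_summable.
pose s k := ereal_sup [set (w n%:Z)%:E | n in [set n | (k <= n)%N]].
have ws (i n : nat) : (i <= n)%N -> ((w n%:Z)%:E <= s i)%E.
  by move=> le_in; apply: ereal_sup_ubound; exists n.
have s0 k : (0 <= s k)%E.
  by apply: le_trans (ws k k _) => //; rewrite lee_fin weight_ge0.
pose S := (\sum_(1 <= k <oo) s k)%E => Soo.
have S0 : (0 <= S)%E by apply: nneseries_ge0 => k _ _; exact: s0.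
exists (fine S) => k; rewrite -lee_fin fineK ?ge0_fin_numE//.
have -> : w k = w `|k|%N%:Z.
  by have [k0|k0] := leP 0 k; [rewrite gez0_abs | rewrite ltz0_abs// /w weightN].
move: `|k|%N => {}k.
apply: le_trans (nneseries_lim_ge k.+1 (fun i _ _ => s0 i)).
rewrite mulr_natl -[X in _ *+ X]subn0 -subSS -sumr_const_nat -sumEFin.
rewrite [leLHS]big_nat [leRHS]big_nat; apply: lee_sum => i /andP[_ ik].
exact: ws.
Qed.

Lemma hilbert_schmidt_of_decay : weight_decreasing G \/ weight_sup_summable G ->
  hilbert_schmidt (commutator (hamiltonian G) cutoff).
Proof.
case=> [/weight_decreasing_bound|/weight_sup_summable_bound[C]];
  exact: hilbert_schmidt_commutator.
Qed.

End weight_decay.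

(** * Independence of the orthonormal basis *)

Section inner_product.
Context {R : realType}.
Implicit Types (f g h : l2 R).

(** Absolute convergence, from [|x * y| <= |x| ^+ 2 + |y| ^+ 2] termwise. *)
Lemma l2_inner_cvg f g :
  partial_sum (fun n => f n * (g n)^* : R[i]^o) J @[J --> totally] -->
  l2_inner f g.
Proof.
apply: (@normc_cvg_sum _ _ _ (l2norm f ^+ 2 + l2norm g ^+ 2)) => J.
have [_ fJ] := l2bound_norm (l2P f); have [_ gJ] := l2bound_norm (l2P g).
apply: le_trans (lerD (fJ J) (gJ J)); rewrite -big_split/=; apply: ler_sum => n _.
have -> : normc (f n * (g n)^*) = normc (f n) * normc (g n).
  rewrite ComplexField.Normc.normcM; congr (_ * _).
  by case: (g n) => a b /=; rewrite sqrrN.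
have := normc_ge0 (f n); have := normc_ge0 (g n).
by have := sqr_ge0 (normc (f n) - normc (g n)); nra.
Qed.

Arguments l2_inner_cvg : clear implicits.

Lemma l2_inner_linearl (c : R[i]) f g h :
  l2_inner (c *: f + g) h = c * l2_inner f h + l2_inner g h.
Proof.
apply: (cvg_unique (@norm_hausdorff _ R[i]^o) (l2_inner_cvg _ _)).
have := cvgD (cvgZr (k := c) (l2_inner_cvg f h)) (l2_inner_cvg g h) => fgh.
rewrite [X in X J @[J --> _]](_ : _ = fun J =>
  c *: partial_sum (fun n => f n * (h n)^* : R[i]^o) J +
  partial_sum (fun n => g n * (h n)^* : R[i]^o) J); first exact: fgh.
apply/funext => J; rewrite !partial_sumE scaler_sumr -big_split.
apply: eq_bigr => n _; rewrite -[LHS]/((c * f n + g n) * (h n)^*) mulrDl -mulrA.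
exact: erefl.
Qed.

Lemma l2_innerC f g : l2_inner g f = (l2_inner f g)^*.
Proof.
apply: (cvg_unique (@norm_hausdorff _ R[i]^o) (l2_inner_cvg _ _)).
apply/cvg_complexP; have /cvg_complexP := l2_inner_cvg f g.
rewrite [X in X J @[J --> _] --> _ -> _](_ : _ = fun J =>
  normc ((l2_inner f g)^* - partial_sum (fun n => g n * (f n)^* : R[i]^o) J)) //.
apply/funext => J; rewrite !partial_sumE.
have -> : \sum_(n <- J) (g n * (f n)^* : R[i]^o) =
    (\sum_(n <- J) (f n * (g n)^* : R[i]))^*.
  rewrite rmorph_sum; apply: eq_bigr => n _.
  by rewrite rmorphM /= conjcK mulrC.
by rewrite -rmorphB; case: (_ - _) => a b /=; rewrite sqrrN.
Qed.

(** The squared norm is defined as a supremum of finite sums, the inner product as a limit along the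
    net of finite sets. For nonnegative terms the two agree. *)
Lemma l2_inner_self f : l2_inner f f = (l2norm f ^+ 2)%:C.
Proof.
apply: (cvg_unique (@norm_hausdorff _ R[i]^o) (l2_inner_cvg _ _)).
have [_ fJ] := l2bound_norm (l2P f).
apply/cvg_complexP/cvgrPdist_lt => e e0.
have [J0 J0P] : exists J : {fset int},
    l2norm f ^+ 2 - e < \sum_(n <- J) normc (f n) ^+ 2.
  apply: contrapT => /forallNP noJ.
  have : (sqnorm f <= (l2norm f ^+ 2 - e)%:E)%E.
    by apply/esum_le_fset => J; rewrite leNgt; apply/negP/noJ.
  by rewrite square_summableE ?l2P// lee_fin; lra.
exists J0 => // J /= J0J.
have sumE : partial_sum (fun n => f n * (f n)^* : R[i]^o) J =
    (\sum_(n <- J) normc (f n) ^+ 2)%:C.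
  rewrite partial_sumE rmorph_sum; apply: eq_bigr => n _ /=.
  case: (f n) => a b /=; rewrite sqr_sqrtr ?addr_ge0 ?sqr_ge0//.
  by apply/eqP; rewrite eq_complex /=; apply/andP; split; apply/eqP; ring.
rewrite sumE -rmorphB sub0r normrN ger0_norm ?normc_ge0//.
rewrite [normc _]normc_real ?subr_ge0//.
have := sum_fset_sub (fun n => sqr_ge0 (normc (f n))) J0J; lra.
Qed.

Lemma l2_inner_suml {I : Type} (s : seq I) (c : I -> R[i]) (e : I -> l2 R) g :
  l2_inner (\sum_(i <- s) c i *: e i) g = \sum_(i <- s) c i * l2_inner (e i) g.
Proof.
elim: s => [|i s IH]; last by rewrite !big_cons l2_inner_linearl IH.
(* Linearity with coefficient -1 at the zero vector gives [l2_inner 0 g = 0]. *)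
rewrite !big_nil; have := l2_inner_linearl (-1) 0 0 g.
by rewrite scaler0 addr0 mulN1r addNr.
Qed.

Lemma l2_inner_subl f g h : l2_inner (f - g) h = l2_inner f h - l2_inner g h.
Proof. by rewrite addrC -scaleN1r l2_inner_linearl mulN1r addrC. Qed.

(** By density some finite combination [f] with coefficients [c i] satisfies [|g - f|^2 <= d].
    Expanding this square and applying [2 |c i| |<e i, g>| <= |c i|^2 + |<e i, g>|^2] termwise
    cancels the coefficients and leaves [|g|^2] at most [d] plus a finite part of the right-hand
    side. *)
Lemma parseval_le {I : choiceType} (e : I -> l2 R) g : orthonormal_basis e ->
  ((l2norm g ^+ 2)%:E <= \esum_(i in setT) (normc (l2_inner (e i) g) ^+ 2)%:E)%E.
Proof.
move=> [ortho dense]; apply/lee_addgt0Pr => d d0.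
have sd : 0 < Num.sqrt d by rewrite sqrtr_gt0.
have : closure [set f : l2 R | exists (J : {fset I}) (c : I -> R[i]),
    f = \sum_(i <- J) c i *: e i] g by rewrite dense.
move=> /l2_closureP/(_ _ sd)[_ [J [c ->]]]; set f := \sum_(i <- J) _ => fg.
have fgd : l2norm (g - f) ^+ 2 <= d.
  by rewrite -[leRHS]sqr_sqrtr ?(ltW d0)// ler_pXn2r ?nnegrE ?l2norm_ge0 ?ltW.
apply: (@le_trans _ _ (\sum_(i <- J) normc (l2_inner (e i) g) ^+ 2 + d)%:E); last first.
  rewrite EFinD leeD2r// -sumEFin; apply: esum_ge.
  exists [set` J]; first by split => //; exact: finite_fset.
  by rewrite fsbig_finite//= set_fsetK.
rewrite lee_fin.
have ff : l2_inner f f = (\sum_(i <- J) normc (c i) ^+ 2)%:C.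
  rewrite l2_inner_suml rmorph_sum/= big_seq [RHS]big_seq; apply: eq_bigr => i iJ.
  rewrite l2_innerC l2_inner_suml (big_fsetD1 i)//= ortho eqxx mulr1.
  rewrite big_seq big1 => [|j]; last first.
    by rewrite !inE => /andP[/negPf ji _]; rewrite ortho ji mulr0.
  rewrite addr0; case: (c i) => a b /=; rewrite sqr_sqrtr ?addr_ge0 ?sqr_ge0//.
  by apply/eqP; rewrite eq_complex /=; apply/andP; split; apply/eqP; ring.
have fgE : l2_inner f g = \sum_(i <- J) c i * l2_inner (e i) g.
  exact: l2_inner_suml.
have dd : l2_inner (g - f) (g - f) =
    l2_inner g g - (l2_inner f g)^* - l2_inner f g + l2_inner f f.
  rewrite l2_inner_subl [l2_inner g (g - f)]l2_innerC.
  rewrite [l2_inner f (g - f)]l2_innerC !l2_inner_subl !rmorphB /=.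
  rewrite -[X in X - _ - _]l2_innerC -[X in _ - (X - _)]l2_innerC.
  by rewrite -[X in _ - (_ - X)]l2_innerC opprB addrA addrAC.
have Re_dd : l2norm (g - f) ^+ 2 = l2norm g ^+ 2 - 2 * complex.Re (l2_inner f g) +
    \sum_(i <- J) normc (c i) ^+ 2.
  have := congr1 (@complex.Re R) dd; rewrite ff !l2_inner_self.
  by case: (l2_inner f g) => a b /= ->; ring.
have Re_le : 2 * complex.Re (l2_inner f g) <=
    \sum_(i <- J) normc (c i) ^+ 2 + \sum_(i <- J) normc (l2_inner (e i) g) ^+ 2.
  rewrite fgE -big_split/= raddf_sum mulr_sumr; apply: ler_sum => i _.
  have [+ _] := ReIm_le_normc (c i * l2_inner (e i) g).
  move=> /(le_trans (ler_norm _)); rewrite ComplexField.Normc.normcM.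
  have := sqr_ge0 (normc (c i) - normc (l2_inner (e i) g)).
  set x := complex.Re _; nra.
lra.
Qed.

End inner_product.

(** * Rows of the commutator and comparison of orthonormal bases *)

(** A bijection of the indices carries the net of finite sets to the net of finite sets. *)
Lemma sum_reindex {R : realType} {I J : choiceType} (s : I -> J) (t : J -> I)
    (x : J -> R[i]^o) (l : R[i]^o) : cancel s t -> cancel t s ->
  partial_sum x A @[A --> totally] --> l -> summability.sum (x \o s) = l.
Proof.
move=> sK tK xl; apply: cvg_lim; first exact: norm_hausdorff.
have -> : partial_sum (x \o s) = partial_sum x \o (fun A => s @` A)%fset.
  apply/funext => A; rewrite /= !partial_sumE big_imfset//=.
  by move=> i j _ _; exact: (can_inj sK).
apply: cvg_comp xl => B [A _ AB]; exists (t @` A)%fset => // C /= AC.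
apply: AB; apply/fsubsetP => j jA; apply/imfsetP; exists (t j); rewrite ?tK//.
by apply: (fsubsetP AC); apply/imfsetP; exists j.
Qed.

Section hilbert_schmidt_delta.
Context {R : realType} (G : periodic_graph R).
Let w := weight G.
Let T := commutator (hamiltonian G) cutoff.

(** Row [n] of the matrix of [T] up to sign. The entries are real, so pairing with this row involves
    no conjugation. *)
Definition kernel_row_fun (n : int) : int -> R[i]^o :=
  far_half n (fun m => (w (m - n))%:C).

(** As [w] is even, the moduli of the matrix entries are symmetric, so row [n] has the moduli of
    column [n]. This makes the row square-summable. *)
Lemma normc_kernel_row n m :
  normc (kernel_row_fun n m) = normc (T (l2_delta n) m).
Proof.
rewrite normc_commutator_delta /kernel_row_fun /far_half eq_sym.
case: ifP => _; first exact: ComplexField.Normc.normc0.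
by rewrite normc_real ?weight_ge0// -weightN opprB.
Qed.

Lemma l2bound_kernel_row n : l2bound (kernel_row_fun n) (l2norm (T (l2_delta n))).
Proof.
apply: (@l2bound_dominated _ (T (l2_delta n))).
  by move=> m; rewrite normc_kernel_row.
exact/l2bound_norm/l2P.
Qed.

Definition kernel_row n : l2 R := L2 (l2boundP (l2bound_kernel_row n)).1.

Lemma normc_commutator_inner (f : l2 R) n :
  normc (T f n) = normc (l2_inner f (kernel_row n)).
Proof.
rewrite normc_commutator; congr normc.
(* The inner product sums over vertices and the convolution over displacements [k]; the translation
   from [k] to [n + k] matches them. *)
rewrite -(sum_reindex (addKr n) (addNKr n) (@l2_inner_cvg R f (kernel_row n))).
apply: (congr1 (@summability.sum _ _ R[i]^o)); apply/funext => k.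
rewrite /= /kernel_row_fun /far_half; case: ifP => _.
  by rewrite rmorph0 !mulr0.
rewrite [n + k]addrC addrK mulrC; congr (_ * _).
exact/esym/(conjc_real (w k)).
Qed.

(* The Hilbert-Schmidt norm computed in the canonical basis is at most the one
   computed in any other: expand [||T^* delta_n||^2] by Parseval. *)
Lemma esum_delta_le {I : choiceType} (e : I -> l2 R) : orthonormal_basis e ->
  (\esum_(n in setT) (l2norm (T (l2_delta n)) ^+ 2)%:E <=
   \esum_(i in setT) (l2norm (T (e i)) ^+ 2)%:E)%E.
Proof.
move=> eP.
apply: (@le_trans _ _
    (\esum_(n in setT) \esum_(i in setT) (normc (T (e i) n) ^+ 2)%:E)%E).
  apply: le_esum => n _.
  apply: (@le_trans _ _ (l2norm (kernel_row n) ^+ 2)%:E).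
    rewrite -!square_summableE ?l2P//; apply: le_esum => m _.
    by rewrite -normc_kernel_row.
  apply: le_trans (parseval_le (kernel_row n) eP) _; apply: le_esum => i _.
  by rewrite normc_commutator_inner.
rewrite esum_exchange => [|n i]; last by rewrite lee_fin sqr_ge0.
by apply: le_esum => i _; rewrite -square_summableE ?l2P.
Qed.

End hilbert_schmidt_delta.

(** * A weight with divergent Hilbert-Schmidt norm *)

Section sparse_weight.
Context {R : realType}.

(** The logarithm recovers [j] when [|k|] is a power of 4. At [k = 0] it is 0, and [0 != 4 ^ 0]
    gives weight 0. *)
Definition sparse_weight (k : int) : R :=
  let j := trunc_log 4 `|k| in if `|k|%N == (4 ^ j)%N then 2 ^- j else 0.

Lemma sparse_weight_ge0 k : 0 <= sparse_weight k.
Proof. by rewrite /sparse_weight; case: ifP => // _; rewrite invr_ge0 exprn_ge0. Qed.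

Lemma sparse_weight_pow j : sparse_weight (4 ^ j)%N%:Z = 2 ^- j.
Proof. by rewrite /sparse_weight absz_nat trunc_expnK// eqxx. Qed.

Lemma sparse_weight0 : sparse_weight 0 = 0.
Proof. by rewrite /sparse_weight absz0 trunc_log0. Qed.

Lemma sparse_weightN k : sparse_weight (- k) = sparse_weight k.
Proof. by rewrite /sparse_weight abszN. Qed.

Lemma sparse_weight_summable :
  (\esum_(k in [set: int]) (sparse_weight k)%:E < +oo)%E.
Proof.
(* The two integers of modulus [4 ^ j] have weight [2 ^- j] each, and the geometric series sums to
   2. *)
apply: (@le_lt_trans _ _ 4%:E); last exact: ltry.
apply/esum_le_fset => J; have [K KP] := fset_int_bounded J.
have pow_sum (n : nat) : \sum_(j < n) 2 ^- j = 2 - 2 * 2 ^- n :> R.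
  elim: n => [|n IH]; first by rewrite big_ord0 expr0 invr1; ring.
  by rewrite big_ord_recr /= IH exprS invfM; field; rewrite expf_neq0.
apply: (@le_trans _ _ (\sum_(k <- J) \sum_(j < K.+1)
    ((k == (4 ^ j)%N%:Z)%:R + (k == - (4 ^ j)%N%:Z)%:R) * 2 ^- j)).
  rewrite big_seq [leRHS]big_seq; apply: ler_sum => k kJ.
  have term_ge0 (j : 'I_K.+1) : 0 <=
      ((k == (4 ^ j)%N%:Z)%:R + (k == - (4 ^ j)%N%:Z)%:R) * 2 ^- j :> R.
    by rewrite mulr_ge0 ?addr_ge0 ?invr_ge0 ?exprn_ge0.
  rewrite /sparse_weight; case: eqP => [kE|_]; last exact: sumr_ge0.
  (* Exponents up to [K] suffice, because [j < 4 ^ j = |k| <= K]. *)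
  have jK : (trunc_log 4 `|k| < K.+1)%N.
    rewrite ltnS (leq_trans _ (KP k kJ))//.
    by rewrite [leqRHS]kE ltnW// ltn_expl.
  rewrite (bigD1 (Ordinal jK))//= -[leLHS]addr0 lerD ?sumr_ge0//.
  rewrite ler_peMl ?invr_ge0 ?exprn_ge0// -kE -natrD ler1n.
  by have [k0|k0] := leP 0 k; [rewrite (_ : k == _)|rewrite addnC (_ : k == _)];
    rewrite ?eqxx//; lia.
rewrite exchange_big /=.
apply: (@le_trans _ _ (\sum_(j < K.+1) 2 * 2 ^- j)).
  apply: ler_sum => j _; rewrite -mulr_suml ler_wpM2r ?invr_ge0 ?exprn_ge0//.
  by rewrite big_split -[2]/(1 + 1) lerD// sum_eq_le1.
rewrite -mulr_sumr pow_sum; have : 0 <= 2 ^- K.+1 :> R by rewrite invr_ge0 exprn_ge0.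
lra.
Qed.

(** The edges of length 1 have weight [2 ^- 0 = 1], so unit steps towards [m] form a path. *)
Lemma sparse_connected (n m : int) : exists s : seq int,
  path (fun a b => 0 < sparse_weight (b - a)) n s /\ last n s = m.
Proof.
have w1 : 0 < sparse_weight 1.
  by rewrite -[1]/((4 ^ 0)%N%:Z) sparse_weight_pow invr_gt0.
have [d] := ubnP (absz (m - n)); elim: d n => // d IH n nm.
have [->|nm0] := eqVneq n m; first by exists [::].
pose n' := if n < m then n + 1 else n - 1.
have [|s [sP sm]] := IH n'; first by rewrite /n'; case: ifP; lia.
exists (n' :: s); split=> //=; rewrite sP andbT /n'; case: ifP => _.
  by rewrite addrC addKr.
by rewrite addrC addKr sparse_weightN.
Qed.

Definition sparse_graph : periodic_graph R :=
  PeriodicGraph 0 sparse_weight_ge0 sparse_weight0 sparse_weightN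
    sparse_weight_summable sparse_connected.

(** A finite Hilbert-Schmidt sum in any basis would bound the sum in the canonical basis by some
    [S]. For each [j], the [4 ^ j] crossing pairs at distance [4 ^ j] with negative column
    contribute [4 ^ j * (2 ^- j) ^+ 2 = 1], so using [M > S] values of [j] is a contradiction. *)
Lemma sparse_graph_not_hilbert_schmidt :
  ~ hilbert_schmidt (commutator (hamiltonian sparse_graph) cutoff).
Proof.
set T := commutator _ _ => -[_ [I [e [eP Te]]]].
have := le_lt_trans (esum_delta_le sparse_graph eP) Te; rewrite -/T.
set S := esum _ _ => Soo.
have S0 : (0 <= S)%E by apply: esum_ge0 => n _; rewrite lee_fin sqr_ge0.
have /esum_le_fset S_le : (S <= (fine S)%:E)%E by rewrite fineK ?ge0_fin_numE.
have [M ltM] : exists M : nat, fine S < M%:R.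
  by exists (Num.bound (fine S)); apply: archi_boundP; exact: fine_ge0.
(* The columns [-1, ..., - 4 ^ M] on the negative side. *)
pose r := [seq - i%:Z - 1 | i <- iota 0 (4 ^ M)].
have ur : uniq r.
  by rewrite map_inj_uniq ?iota_uniq// => i j /addIr/oppr_inj[].
have := S_le (seq_fset tt r); rewrite -sum_fset_uniq// big_map.
apply/negP; rewrite -ltNge; apply: lt_le_trans ltM _.
apply: (@le_trans _ _ (\sum_(i <- iota 0 (4 ^ M)) \sum_(j <- iota 0 M)
    (if (i < 4 ^ j)%N then (2 ^- j) ^+ 2 else 0))); last first.
  apply: ler_sum => i _; have [_] := l2bound_norm (l2P (T (l2_delta (- i%:Z - 1)))).
  (* Rows at distance [4 ^ j] from column [- i - 1]; such a row lies across the cut exactly when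
     [i < 4 ^ j]. *)
  pose q := [seq (4 ^ j)%N%:Z - i%:Z - 1 | j <- iota 0 M].
  have uq : uniq q.
    rewrite map_inj_uniq ?iota_uniq// => j l /addIr/addIr[/eqP].
    by rewrite eqn_exp2l// => /eqP.
  move=> /(_ (seq_fset tt q)); apply: le_trans.
  rewrite -sum_fset_uniq// big_map; apply: ler_sum => j _.
  case: ifPn => [ij|_]; last exact: sqr_ge0.
  rewrite normc_commutator_delta ifF; last by lia.
  rewrite -sparse_weight_pow -sparse_weightN ler_pXn2r ?nnegrE ?sparse_weight_ge0//.
  by rewrite [leRHS](_ : _ = sparse_weight (- (4 ^ j)%N%:Z))//; congr sparse_weight; lia.
rewrite exchange_big /= -[X in X%:R](size_iota 0) -sum1_size natr_sum.
rewrite big_seq [leRHS]big_seq; apply: ler_sum => j.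
rewrite mem_iota add0n => /andP[_ jM].
rewrite -big_mkcond big_const_seq iter_addr_0 -[leRHS]mulr_natl -size_filter.
(* Since [j < M], all of the indices [i < 4 ^ j] occur among the chosen columns. *)
have -> : size [seq i <- iota 0 (4 ^ M) | (i < 4 ^ j)%N] = (4 ^ j)%N.
  rewrite -[RHS](size_iota 0); apply/perm_size/uniq_perm.
  - by rewrite filter_uniq ?iota_uniq.
  - exact: iota_uniq.
  move=> i; rewrite mem_filter !mem_iota !add0n /=.
  case: ltnP => //= ij; rewrite (leq_trans ij)// leq_exp2l//; exact: ltnW.
have pow4 : (4 ^ j)%N%:R = (2 ^+ j) ^+ 2 :> R.
  by rewrite -!natrX -expnM mulnC expnM.
by rewrite pow4 exprVn mulfV// !expf_neq0.
Qed.

End sparse_weight.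

Theorem proposition2p13 (R : realType) :
  (forall G : periodic_graph R,
     compact_operator (commutator (hamiltonian G) cutoff) /\
     essentially_local (hamiltonian G)) /\
  (forall G : periodic_graph R,
     weight_decreasing G \/ weight_sup_summable G ->
     hilbert_schmidt (commutator (hamiltonian G) cutoff)) /\
  (exists G : periodic_graph R,
     ~ hilbert_schmidt (commutator (hamiltonian G) cutoff)).
Proof.
split; [|split].
- move=> G; have cG := compact_commutator G.
  by split=> //; split=> //; exact: bounded_hamiltonian.
- exact: hilbert_schmidt_of_decay.
- by exists sparse_graph; exact: sparse_graph_not_hilbert_schmidt.
Qed.
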